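(* Let $H$ be a Hilbert space with orthonormal basis $\{\varphi_i\}_{i=1}^\infty$, and let $E:H\to\mathbb{R}$ be a convex function such that $\Omega:=\{x\in H: E(x)\le E(0)\}$ is bounded. Assume that $E$ satisfies Conditions 0, 1 and 2 stated in the context, with constants $M_0$, $M>0$, $\alpha>0$, $1<q\le 2$, $\beta>0$, $2\le p<\infty$. Suppose that the problem $\inf_{x\in\Omega}E(x)$ has a solution $\bar x=\sum_i c_i(\bar x)\varphi_i\in\Omega$ whose support $\bar S:=\{i: c_i(\bar x)\neq 0\}$ is finite, with cardinality $|\bar S|$. Let $(x_k)_{k\ge 0}$ be any sequence generated by the algorithm OMP(co) (defined in the context) applied to $E$ and $\{\varphi_i\}$, and let $e_k:=E(x_k)-E(\bar x)$. Then at Step $k$ either $x_k=\bar x$, in which case $e_k=0$, or the following holds. (i) When $p\neq q$, for $k=2,3,\ldots$, $$e_k\le C\,|\bar S|^{\frac{pq}{2(p-q)}}\,k^{-\frac{p(q-1)}{p-q}},\qquad \|x_k-\bar x\|\le C'\,|\bar S|^{\frac{q}{2(p-q)}}\,k^{-\frac{q-1}{p-q}},$$ where $C$ and $C'$ depend only on $p,q,\alpha,\beta,E$. (ii) When $p=q=2$, for $k=2,3,\ldots$, $$e_k\le C_2\,\gamma^{k-1},\qquad \|x_k-\bar x\|\le C_2^{1/2}\beta_0^{-1/2}\gamma^{(k-1)/2},$$ where $\gamma:=1-\frac{\tilde C_3}{|\bar S|}$ is in $(0,1)$, $C_2=E(0)-E(\bar x)$, $\tilde C_3$ is a constant that depends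 on $\alpha$, $\beta$ and $E$, and $\beta_0>0$ is the constant described in the context.
   Context: $\langle\cdot,\cdot\rangle$ and $\|\cdot\|$ are the inner product and norm of $H$; $E'(x)\in H$ denotes the Fréchet derivative (gradient) of $E$ at $x$. Condition 0: $E$ has a Fréchet derivative $E'(x)\in H$ at each $x\in\Omega$ and $\|E'(x)\|\le M_0$ for all $x\in\Omega$. Condition 1: for all $x\in\Omega$, $x'\in H$ with $\|x-x'\|\le M$: $E(x')-E(x)-\langle E'(x),x'-x\rangle\le\alpha\|x'-x\|^q$. Condition 2: for all $x\in\Omega$, $x'\in H$ with $\|x-x'\|\le M$: $E(x')-E(x)-\langle E'(x),x'-x\rangle\ge\beta\|x'-x\|^p$. Constant $\beta_0$: since $\Omega$ is convex and bounded, Condition 2 implies that there is $\beta_0>0$ with $E(x')-E(x)-\langle E'(x),x'-x\rangle\ge\beta_0\|x'-x\|^p$ for all $x,x'\in\Omega$; one may take $\beta_0=\min\{\beta,\beta L^{1-p}\}$ where $L>0$ is such that $\mathrm{diam}(\Omega)\le LM$. Here $\beta_0$ denotes this constant. Algorithm OMP(co), with dictionary $\mathcal{D}=\{\pm\varphi_j\}_{j=1}^\infty$: Step 0: set $x_0:=0$. If $E'(x_0)=0$, stop and set $x_k:=x_0$ for $k\ge1$. Step $m$ ($m\ge1$): assuming $x_{m-1}$ has been defined and $E'(x_{m-1})\ne0$, choose $\varphi_{j_m}$ maximizing $|\langle E'(x_{m-1}),\varphi\rangle|$ over $\varphi\in\mathcal{D}$, and let $x_m$ be a minimizer of $E$ over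 $\mathrm{span}\{\varphi_{j_1},\dots,\varphi_{j_m}\}$. If $E'(x_m)=0$, stop and set $x_k:=x_m$ for $k>m$; otherwise go to Step $m+1$. The sequence generated need not be unique; the result applies to any sequence generated by the algorithm. *)

(* Defs.v *)
From mathcomp Require Import all_boot all_order all_algebra finmap.
From mathcomp Require Import all_classical all_reals all_analysis.
From mathcomp Require Import ring lra.
Set Implicit Arguments.
Unset Strict Implicit.
Unset Printing Implicit Defensive.
Import Order.TTheory GRing.Theory Num.Theory.
Import numFieldNormedType.Exports.
Local Open Scope classical_set_scope.
Local Open Scope ring_scope.

Section Greedy.
Context {R : realType} {H : completeNormedModType R}.
Variable ip : {dot H for idfun}.
Implicit Types (E : H -> R) (dE : H -> H) (phi : nat -> H) (x : nat -> H).

(* A real Hilbert space is a complete normed space whose norm comes from ip. *)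
Definition norm_from_dot := forall u : H, `|u| ^+ 2 = ip u u.

Definition coef phi (u : H) (i : nat) : R := ip u (phi i).

Definition orthonormal_basis phi :=
  (forall i j, ip (phi i) (phi j) = (i == j)%:R) /\
  (forall u : H, series (fun i => coef phi u i *: phi i) @ \oo --> u).

Definition supp phi (u : H) : set nat := [set i | coef phi u i != 0].

Definition Omega E : set H := [set u | E u <= E 0].

Definition solves_inf E (xbar : H) :=
  Omega E xbar /\ (forall u, Omega E u -> E xbar <= E u).

Definition is_gradient E (u g : H) := is_diff u E (fun h => ip g h).

Definition condition0 E dE (M0 : R) :=
  forall u, Omega E u -> is_gradient E u (dE u) /\ `|dE u| <= M0.

(* dE always stands for the gradient E' of E; only its values on Omega matter. *)
Definition remainder E dE (u v : H) : R := E v - E u - ip (dE u) (v - u).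

Definition condition1 E dE (M alpha q : R) :=
  forall u v, Omega E u -> `|u - v| <= M ->
    remainder E dE u v <= alpha * `|v - u| `^ q.

Definition condition2 E dE (M beta p : R) :=
  forall u v, Omega E u -> `|u - v| <= M ->
    remainder E dE u v >= beta * `|v - u| `^ p.

(* The constants beta0 for which condition 2 holds between any two points of
   Omega; lemma [beta0_min] below exhibits one. *)
Definition is_beta0 E dE (p beta0 : R) :=
  0 < beta0 /\
  forall u v, Omega E u -> Omega E v ->
    remainder E dE u v >= beta0 * `|v - u| `^ p.

Definition dictionary phi : set H :=
  [set g | exists i, g = phi i \/ g = - phi i].

(* span {phi_{j_1}, ..., phi_{j_m}} *)
Definition span_selected phi (j : nat -> nat) (m : nat) : set H :=
  [set u | exists c : nat -> R, u = \sum_(1 <= i < m.+1) c i *: phi (j i)].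

Definition is_minimizer E (A : set H) (u : H) :=
  A u /\ (forall v, A v -> E u <= E v).

(* Once dE (x m) = 0 the first clause makes x constant from m on, which is the
   stopping rule. The indices j_m chosen at the steps after the stop, and j 0,
   are irrelevant. *)
Definition OMP_co E dE phi x :=
  x 0%N = 0 /\
  exists j : nat -> nat, forall m : nat,
    (dE (x m) = 0 -> x m.+1 = x m) /\
    (dE (x m) <> 0 ->
       (forall g, dictionary phi g ->
          `|ip (dE (x m)) g| <= `|ip (dE (x m)) (phi (j m.+1))|) /\
       is_minimizer E (span_selected phi j m.+1) (x m.+1)).

Lemma beta0_min E dE (M beta p L : R) :
  convex_function [set: H] E -> 0 < M -> 0 < beta ->
  condition2 E dE M beta p -> 0 < L ->
  (forall u v, Omega E u -> Omega E v -> `|u - v| <= L * M) ->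
  is_beta0 E dE p (Num.min beta (beta * L `^ (1 - p))).
Proof.
move=> Ecvx M0 b0 c2 L0 diam; split.
  by rewrite lt_min b0 mulr_gt0// powR_gt0.
move=> u v uO vO.
have [uvM|uvM] := leP `|u - v| M.
  apply: le_trans (c2 u v uO uvM).
  by rewrite ler_wpM2r ?powR_ge0// ge_min lexx.
have L1 : 1 < L.
  rewrite ltNge; apply/negP => L1.
  have /(lt_le_trans uvM) := diam u v uO vO.
  by rewrite ltNge => /negP; apply; rewrite ler_piMl// ltW.
have t0 : 0 <= L^-1 by rewrite invr_ge0 ltW.
have t1 : L^-1 <= 1 by rewrite invf_le1// ltW.
pose t : {i01 R} := Itv01 t0 t1.
have := Ecvx t v u (mem_set I) (mem_set I).
rewrite convRE.
have -> : (conv t (v : convex_lmodType H) u : H) = u + L^-1 *: (v - u).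
  by rewrite /conv/= scalerBl scale1r scalerBr addrCA.
rewrite /= /unstable.onem; set w := u + _ => cvx.
have wu : w - u = L^-1 *: (v - u) by rewrite /w addrAC subrr add0r.
have nwu : `|w - u| = L^-1 * `|v - u| by rewrite wu normrZ ger0_norm.
have uwM : `|u - w| <= M.
  by rewrite distrC nwu mulrC ler_pdivrMr// mulrC distrC diam.
have := c2 u w uO uwM.
rewrite /remainder nwu wu linearZ/= powRM//.
set d := ip _ _; set n := `|v - u| `^ p => c2w.
have key : beta * (L^-1 `^ p * n) <= L^-1 * (E v - E u - d) by lra.
apply: (@le_trans _ _ (beta * L `^ (1 - p) * n)).
  by rewrite ler_wpM2r ?powR_ge0// ge_min lexx orbT.
rewrite -(ler_pM2l (_ : 0 < L^-1)) ?invr_gt0//.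
apply: le_trans key; rewrite le_eqVlt; apply/orP; left; apply/eqP.
have -> : L `^ (1 - p) = L / L `^ p.
  by rewrite powRD ?(gt_eqF L0) ?implybT// (powRr1 (ltW L0)) powRN.
have -> : L^-1 `^ p = (L `^ p)^-1.
  by rewrite -(powR_inv1 (ltW L0)) -powRrM mulN1r powRN.
by field; rewrite !gt_eqF// powR_gt0.
Qed.

End Greedy.

(* Main.v *)
Require Import Defs.
From mathcomp Require Import all_boot all_order all_algebra finmap.
From mathcomp Require Import all_classical all_reals all_analysis.
From mathcomp Require Import ring lra.
Import Order.TTheory GRing.Theory Num.Theory.
Import numFieldNormedType.Exports.
Local Open Scope classical_set_scope.
Local Open Scope ring_scope.

(** The theorem combines a lower bound on how much one step gains with an upper
  bound on how much there is left to gain, both in terms of the largest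
  correlation A of the gradient at x_m with a basis vector. Write
  e_m = E(x_m) - E(xbar), r = |x_m - xbar| and S for the size of the support
  of xbar.

  Gain. Moving from x_m along the best correlated basis vector stays inside the
  span searched at the next step, and by condition 1 a step of length
  proportional to A^(1/(q-1)) lowers E by at least K A^(q/(q-1)) ([descent]).

  Gap. Since x_m minimizes E over the selected span, E'(x_m) is orthogonal to
  every selected vector ([line_minimizer_orthogonal]), hence to x_m. So
  e_m <= -<E'(x_m), xbar>, and only the part of xbar outside the selected
  vectors contributes. On these indices the coefficients of xbar and of
  xbar - x_m agree, so Cauchy-Schwarz over at most S of them and Bessel's
  inequality give e_m <= A sqrt(S) r ([sparse_gap]). Condition 2 at xbar, where
  the gradient vanishes, gives beta0 r^p <= e_m ([growth]). Eliminating r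
  bounds A below by a multiple of e_m^(1-1/p) / sqrt(S)
  ([correlation_lower_bound]).

  Together ([omp_recurrence]),
    e_(m+1) <= e_m - K' S^(-q/(2(q-1))) e_m^(1+theta),
  with theta = (p-q)/(p(q-1)). If p = q = 2 then theta = 0 and the decay is
  geometric ([omp_linear_rate]). If q < p then theta > 0 and e_m^(-theta) grows
  at least linearly ([powR_recurrence_rate]), which is the power rate
  ([omp_power_rate]). The distances follow from [growth].

  The constants K and beta0 are computed from bounds M and M0 that come after
  them in the theorem. This is harmless: gradients are unique, so if the
  conditions hold for E with some bounds, then these bounds serve for any other
  choice of gradient map as well ([conditions_transfer]), and one admissible
  choice can be fixed in advance. *)

(** * Scalar recurrences and sums *)

Section Recurrence.
Set Implicit Arguments.
Unset Strict Implicit.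
Context {R : realType}.
Implicit Types (e : nat -> R) (K theta : R).

Lemma bernoulli_powRN theta (y : R) : 0 <= theta -> y < 1 ->
  1 + theta * y <= (1 - y) `^ (- theta).
Proof.
move=> theta0 y1; have y1' : 0 < 1 - y by rewrite subr_gt0.
rewrite /powR gt_eqF//; apply: le_trans (expR_ge1Dx _).
rewrite lerD2l mulNr -mulrN ler_wpM2l// lerNr.
by apply: le_ln1Dx; rewrite ltrN2.
Qed.

(** The recurrence discretizes a' = - K a^(1+theta), along which a^(-theta) has
  the constant slope theta K. The inequality survives discretization because
  the Bernoulli inequality for the negative exponent goes the right way. *)
Lemma powRN_recurrence_step theta K (a b : R) : 0 < theta -> 0 < b -> 0 < a ->
  b <= a - K * a `^ (1 + theta) ->
  a `^ (- theta) + theta * K <= b `^ (- theta).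
Proof.
move=> theta0 b0 a0 ba; pose y := K * a `^ theta.
have bay : b <= a * (1 - y).
  apply: le_trans ba _; rewrite powRD ?(gt_eqF a0) ?implybT// (powRr1 (ltW a0)).
  by rewrite le_eqVlt; apply/orP; left; apply/eqP; rewrite /y; ring.
have y1 : 0 < 1 - y by rewrite -(pmulr_rgt0 _ a0) (lt_le_trans b0).
have a_gt0 := powR_gt0 theta a0.
have -> : a `^ (- theta) + theta * K = a `^ (- theta) * (1 + theta * y).
  by rewrite powRN /y; field; rewrite gt_eqF.
apply: (@le_trans _ _ ((a * (1 - y)) `^ (- theta))).
  rewrite powRM ?(ltW a0) ?(ltW y1)// ler_wpM2l ?powR_ge0//.
  by rewrite bernoulli_powRN ?(ltW theta0)// -subr_gt0.
rewrite !powRN lef_pV2 ?posrE ?powR_gt0 ?mulr_gt0//.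
by rewrite ge0_ler_powR ?nnegrE ?mulr_ge0 ?(ltW theta0) ?(ltW b0) ?(ltW a0) ?(ltW y1).
Qed.

Lemma powR_recurrence_rate theta K e (k : nat) : 0 < theta -> 0 < K ->
  (forall m, (m <= k)%N -> 0 < e m) ->
  (forall m, (m < k)%N -> e m.+1 <= e m - K * e m `^ (1 + theta)) ->
  (0 < k)%N -> e k <= (theta * K * k%:R) `^ (- theta^-1).
Proof.
move=> theta0 K0 epos erec k0.
have key m : (m <= k)%N -> theta * K * m%:R <= e m `^ (- theta).
  elim: m => [_|m IH mk]; first by rewrite mulr0 powR_ge0.
  have := powRN_recurrence_step theta0 (epos _ mk) (epos _ (ltnW mk)) (erec _ mk).
  by apply: le_trans; rewrite -natr1 mulrDr mulr1 lerD2r IH// ltnW.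
have P0 : 0 < theta * K * k%:R by rewrite !mulr_gt0// ltr0n.
have ek0 := epos _ (leqnn k).
have -> : e k = (e k `^ (- theta)) `^ (- theta^-1).
  by rewrite -powRrM mulrNN mulfV ?gt_eqF// powRr1// ltW.
rewrite ![_ `^ (- theta^-1)]powRN lef_pV2 ?posrE ?powR_gt0//.
by rewrite ge0_ler_powR ?nnegrE ?invr_ge0 ?powR_ge0 ?(ltW theta0) ?(ltW P0) ?key.
Qed.

(** Cauchy-Schwarz against a constant, from the nonnegative sum of the squares
  (a i - t)^2. *)
Lemma sum_le_sqrt_size (s : seq nat) (a : nat -> R) :
  \sum_(i <- s) a i <=
    Num.sqrt (size s)%:R * Num.sqrt (\sum_(i <- s) a i ^+ 2).
Proof.
set Q := \sum_(i <- s) a i ^+ 2; set A := \sum_(i <- s) a i.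
have Q0 : 0 <= Q by apply: sumr_ge0 => i _; exact: sqr_ge0.
rewrite -sqrtrM//; apply: le_trans (ler_norm _) _.
rewrite -sqrtr_sqr ler_wsqrtr//.
have key t : 2 * t * A <= (size s)%:R * t ^+ 2 + Q.
  rewrite /A /Q; elim: (s) => [|i s' IH]; first by rewrite !big_nil/=; lra.
  rewrite !big_cons /= -natr1; have := sqr_ge0 (a i - t); move: IH.
  by set u := \sum_(_ <- _) _; set v := \sum_(_ <- _) _; nra.
have [s0|s0] := posnP (size s).
  rewrite s0 mul0r; move: key; rewrite s0 => key.
  have -> : A = 0 by rewrite /A (size0nil s0) big_nil.
  by rewrite expr0n.
have n0 : 0 < (size s)%:R :> R by rewrite ltr0n.
have := key (A / (size s)%:R); rewrite -(ler_pM2l n0).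
set n := (size s)%:R.
have -> : n * (2 * (A / n) * A) = 2 * A ^+ 2 by field; rewrite gt_eqF.
have -> : n * (n * (A / n) ^+ 2 + Q) = A ^+ 2 + n * Q by field; rewrite gt_eqF.
by lra.
Qed.

End Recurrence.

(** * Orthonormal systems *)

Section Hilbert.
Set Implicit Arguments.
Unset Strict Implicit.
Context {R : realType} {H : completeNormedModType R}.
Context (ip : {dot H for idfun}) (Hip : norm_from_dot ip).
Implicit Types (u v g h : H) (phi : nat -> H).

Lemma sqr_normB u v : `|u - v| ^+ 2 = `|u| ^+ 2 - 2 * ip u v + `|v| ^+ 2.
Proof. by rewrite !Hip hnormB expr0 mul1r /=; ring. Qed.

Lemma ip_unit_le u g : `|g| = 1 -> `|ip u g| <= `|u|.
Proof.
move=> g1; rewrite -ler_sqr ?nnegrE// real_normK ?num_real//.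
have := sqr_ge0 (`|u - ip u g *: g|).
rewrite sqr_normB normrZ g1 linearZr_LR/= mulr1 real_normK ?num_real//.
by set a := ip u g => ?; rewrite -/a; nra.
Qed.

Lemma ip_eq0 g : (forall h, ip g h = 0) -> g = 0.
Proof.
by move=> /(_ g) g0; apply/eqP; rewrite -normr_eq0 -sqrf_eq0 Hip g0.
Qed.

Lemma gradient_unique (E : H -> R) u g h :
  is_gradient ip E u g -> is_gradient ip E u h -> g = h.
Proof.
move=> [dg eg] [dh eh]; apply/eqP; rewrite -subr_eq0; apply/eqP.
apply: ip_eq0 => v; rewrite linearBl/=; apply/eqP; rewrite subr_eq0; apply/eqP.
by move: (congr1 (@^~ v) eg) (congr1 (@^~ v) eh) => /= <- <-.
Qed.

Section Orthonormal.
Context (phi : nat -> H) (phiP : forall i j, ip (phi i) (phi j) = (i == j)%:R).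

Lemma norm_orthonormal i : `|phi i| = 1.
Proof.
have : `|phi i| ^+ 2 = 1 by rewrite Hip phiP eqxx.
by move/eqP; rewrite sqrp_eq1// => /eqP.
Qed.

Lemma coef_sum (s : seq nat) (c : nat -> R) i : uniq s ->
  ip (\sum_(k <- s) c k *: phi k) (phi i) = if i \in s then c i else 0.
Proof.
move=> us; rewrite linear_sumlz /=.
under eq_bigr do rewrite linearZl_LR /= phiP.
case: ifPn => [is_|is_].
  rewrite (bigD1_seq i)//= eqxx mulr1 big1 ?addr0// => k /negPf ->.
  by rewrite mulr0.
rewrite big_seq big1// => k ks; rewrite (_ : k == i = false) ?mulr0//.
by apply: contraNF is_ => /eqP <-.
Qed.

Lemma bessel (s : seq nat) u : uniq s ->
  \sum_(i <- s) coef ip phi u i ^+ 2 <= `|u| ^+ 2.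
Proof.
move=> us; set w := \sum_(i <- s) coef ip phi u i *: phi i.
set Q := \sum_(_ <- _) _.
have uw : ip u w = Q.
  rewrite linear_sumr /=; apply: eq_bigr => i _.
  by rewrite linearZr_LR /= expr2.
have ww : `|w| ^+ 2 = Q.
  rewrite Hip {2}/w linear_sumr /= /Q big_seq [RHS]big_seq.
  apply: eq_bigr => i is_.
  by rewrite linearZr_LR /= coef_sum// is_ expr2.
by have := sqr_ge0 (`|u - w|); rewrite sqr_normB uw ww; lra.
Qed.

End Orthonormal.

(** The difference of the two sides has all its coefficients zero, so it is the
  limit of a null series. *)
Lemma finite_expansion phi u : orthonormal_basis ip phi ->
  finite_set (supp ip phi u) ->
  u = \sum_(i <- fset_set (supp ip phi u)) coef ip phi u i *: phi i.
Proof.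
move=> [phiP cvg] fin; set w := \sum_(i <- _) _.
apply/eqP; rewrite -subr_eq0; apply/eqP.
have c0 i : coef ip phi (u - w) i = 0.
  rewrite /coef linearBl /= coef_sum ?fset_uniq//.
  rewrite in_fset_set//; case: ifPn => [_|]; first by rewrite subrr.
  by rewrite notin_setE /supp /= => /negP; rewrite negbK subr0 => /eqP.
have := cvg (u - w); rewrite (_ : series _ = cst 0).
  by move/(cvg_unique _ (cvg_cst _)) => ->.
by apply/funext => n; rewrite /series /= big1// => i _; rewrite c0 scale0r.
Qed.

(** Sparsity enters here. Where x is supported, d is orthogonal to the basis;
  so pairing d with u only sees the coefficients of u off the support of x,
  and there u and u - x have the same coefficients. The l1 norm of at most
  size s such coefficients is controlled by the l2 norm of u - x. *)
Lemma sparse_gap phi (s : seq nat) d u x (A : R) :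
  (forall i j, ip (phi i) (phi j) = (i == j)%:R) -> uniq s ->
  u = \sum_(i <- s) coef ip phi u i *: phi i ->
  (forall i, `|ip d (phi i)| <= A) ->
  (forall i, ip d (phi i) = 0 \/ coef ip phi x i = 0) ->
  `|ip d u| <= A * Num.sqrt (size s)%:R * `|u - x|.
Proof.
move=> phiP us us_ dA split_.
have A0 : 0 <= A := le_trans (normr_ge0 _) (dA 0%N).
have -> : ip d u = \sum_(i <- s) coef ip phi (u - x) i * ip d (phi i).
  rewrite {1}us_ linear_sumr /=; apply: eq_bigr => i _.
  rewrite linearZr_LR /= /coef linearBl /=.
  have [->|] := split_ i; first by rewrite !mulr0.
  by rewrite /coef => ->; rewrite subr0.
apply: le_trans (ler_norm_sum _ _ _) _.
apply: (@le_trans _ _ (\sum_(i <- s) A * `|coef ip phi (u - x) i|)).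
  by apply: ler_sum => i _; rewrite normrM mulrC ler_wpM2r.
rewrite -mulr_sumr -mulrA ler_wpM2l//.
apply: le_trans (sum_le_sqrt_size s _) _.
rewrite ler_wpM2l ?sqrtr_ge0//.
rewrite -[leRHS]ger0_norm // -sqrtr_sqr.
rewrite ler_wsqrtr//; under eq_bigr do rewrite real_normK ?num_real//.
exact: bessel.
Qed.

End Hilbert.

(** * Energy decrease and growth *)

Section Energy.
Set Implicit Arguments.
Unset Strict Implicit.
Context {R : realType} {H : completeNormedModType R}.
Context (ip : {dot H for idfun}) (Hip : norm_from_dot ip).
Implicit Types (E : H -> R) (dE : H -> H) (u v g h : H) (phi : nat -> H).

(** Along -sg(d) g, with a = |d|, a step of length s changes E by at most
  - s a + alpha s^q, which is minimal for s of order a^(1/(q-1)). *)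
Lemma descent (M0 M alpha q : R) : 0 < M -> 0 < alpha -> 1 < q ->
  exists2 K : R, 0 < K & forall E dE,
    condition0 ip E dE M0 -> condition1 ip E dE M alpha q ->
    forall u g, Omega E u -> `|g| = 1 ->
      exists t, E (u + t *: g) <= E u - K * `|ip (dE u) g| `^ (q / (q - 1)).
Proof.
move=> M_gt0 a_gt0 q1; have q1' : 0 < q - 1 by rewrite subr_gt0.
pose r := (q - 1)^-1; have r0 : 0 < r by rewrite invr_gt0.
pose N : R := `|M0| + 1; have N0 : 0 < N by rewrite ltr_wpDl.
have Nr0 : 0 < N `^ r := powR_gt0 r N0.
have ia0 : 0 < (2 * alpha)^-1 by rewrite invr_gt0 mulr_gt0.
(* The first term keeps the step below M, because a <= N; the second makes
   alpha s^q at most half of the linear gain s a. *)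
pose c := Num.min (M / N `^ r) ((2 * alpha)^-1 `^ r).
have c0 : 0 < c by rewrite lt_min divr_gt0//= powR_gt0.
exists (c / 2); first by rewrite divr_gt0.
move=> E dE C0 C1 u g uO g1; set d := ip (dE u) g; set a : R := `|d|.
have a0 : 0 <= a by rewrite normr_ge0.
have aN : a <= N.
  apply: le_trans (ip_unit_le Hip (dE u) g1) _.
  apply: le_trans (C0 _ uO).2 _; apply: le_trans (ler_norm _) _.
  by rewrite lerDl.
pose s : R := c * a `^ r.
have s0 : 0 <= s by rewrite mulr_ge0 ?powR_ge0 ?(ltW c0).
have sM : s <= M.
  apply: (@le_trans _ _ (c * N `^ r)).
    by rewrite ler_wpM2l ?(ltW c0)// ge0_ler_powR ?nnegrE ?(ltW r0) ?(ltW N0).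
  by rewrite -ler_pdivlMr// ge_min lexx.
have cq : alpha * c `^ (q - 1) <= 1 / 2.
  have : c `^ (q - 1) <= (2 * alpha)^-1.
    have -> : (2 * alpha)^-1 = ((2 * alpha)^-1 `^ r) `^ (q - 1).
      by rewrite -powRrM mulVf ?gt_eqF// powRr1// ltW.
    by rewrite ge0_ler_powR ?nnegrE ?powR_ge0 ?(ltW c0) ?(ltW q1')// ge_min lexx orbT.
  rewrite -(ler_pM2l a_gt0) (_ : alpha * (2 * alpha)^-1 = 1 / 2)//.
  by field; rewrite gt_eqF.
have sq : alpha * s `^ q <= s * a / 2.
  have -> : s `^ q = s * (c `^ (q - 1) * a).
    rewrite -(mulr_powRB1 s0) ?(lt_trans _ q1)//; congr (_ * _).
    rewrite /s powRM ?powR_ge0 ?(ltW c0)// -powRrM mulVf ?gt_eqF//.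
    by rewrite powRr1.
  rewrite (_ : _ * _ = alpha * c `^ (q - 1) * (s * a)); last by ring.
  rewrite (_ : s * a / 2 = 1 / 2 * (s * a)); last by field.
  by rewrite ler_wpM2r // (mulr_ge0 s0 a0).
exists (- Num.sg d * s).
set t := - Num.sg d * s.
have nt : `|t *: g| `^ q <= s `^ q.
  rewrite normrZ g1 mulr1 ge0_ler_powR ?nnegrE ?(ltW (lt_trans _ q1))//.
  rewrite normrM normrN normr_sg (ger0_norm s0).
  by case: (d != 0); rewrite ?mul1r ?mul0r.
have ntM : `|u - (u + t *: g)| <= M.
  rewrite distrC addrAC subrr add0r normrZ g1 mulr1.
  rewrite normrM normrN normr_sg (ger0_norm s0).
  by case: (d != 0); rewrite ?mul1r ?mul0r ?(ltW M_gt0).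
have := C1 u (u + t *: g) uO ntM.
rewrite /remainder [u + _ - u]addrAC subrr add0r linearZr_LR /= -/d.
have -> : t * d = - (s * a).
  by rewrite /t mulrAC mulNr -normrEsg mulNr mulrC.
have -> : a `^ (q / (q - 1)) = a `^ r * a.
  have -> : q / (q - 1) = r + 1 by rewrite /r; field; rewrite gt_eqF.
  by rewrite powRD ?powRr1// gt_eqF// addr_gt0.
have : alpha * `|t *: g| `^ q <= alpha * s `^ q by rewrite ler_wpM2l ?(ltW a_gt0).
have -> : c / 2 * (a `^ r * a) = s * a / 2 by rewrite /s; field.
by move: sq; lra.
Qed.

Section DescentConsequences.
Context (E : H -> R) (dE : H -> H) (K q : R) (K_gt0 : 0 < K).
Context (descentE : forall u g, Omega E u -> `|g| = 1 ->
      exists t, E (u + t *: g) <= E u - K * `|ip (dE u) g| `^ (q / (q - 1))).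

(** First-order condition, read off from the guaranteed decrease: a nonzero
  slope along g would allow a strictly better point of the line. *)
Lemma line_minimizer_orthogonal u g : Omega E u ->
  (forall t, E u <= E (u + t *: g)) -> ip (dE u) g = 0.
Proof.
move=> uO umin; have [->|g0] := eqVneq g 0; first by rewrite linear0r.
have g0' : 0 < `|g| by rewrite normr_gt0.
have g1 : `|(`|g|^-1 *: g)| = 1.
  by rewrite normrZ normfV normr_id mulVf ?gt_eqF.
have [t] := descentE uO g1; rewrite scalerA => Et.
have := le_trans (umin _) Et.
rewrite lerBrDr gerDl pmulr_rle0// => le0.
have : `|ip (dE u) (`|g|^-1 *: g)| `^ (q / (q - 1)) = 0.
  by apply/eqP; rewrite eq_le le0 powR_ge0.
move/powR_eq0_eq0/normr0_eq0; rewrite linearZr_LR /= => /eqP.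
by rewrite mulf_eq0 invr_eq0 gt_eqF//= => /eqP.
Qed.

Lemma gradient0_at_solution xbar : solves_inf E xbar -> dE xbar = 0.
Proof.
move=> [xO xmin]; apply: (ip_eq0 Hip) => h.
apply: line_minimizer_orthogonal => // t.
(* Points outside Omega lie above E 0, hence above the minimum. *)
have [vO|vO] := leP (E (xbar + t *: h)) (E 0); first exact: xmin.
by apply: le_trans (ltW vO); exact: xO.
Qed.

Lemma growth (p beta0 : R) xbar u : is_beta0 ip E dE p beta0 ->
  solves_inf E xbar -> Omega E u ->
  beta0 * `|u - xbar| `^ p <= E u - E xbar.
Proof.
move=> [b0 b0P] sol uO; have [xO _] := sol.
have := b0P _ _ xO uO.
by rewrite /remainder gradient0_at_solution// linear0l subr0.
Qed.

(** Only E on Omega is constrained, but that is enough: the lower bound of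
  condition 2 between u and xbar has no linear term. *)
Lemma gradient0_eq_solution (p beta0 : R) xbar u : 0 < p ->
  is_beta0 ip E dE p beta0 ->
  solves_inf E xbar -> Omega E u -> dE u = 0 -> E u = E xbar.
Proof.
move=> p0 [b0 b0P] [xO xmin] uO du0; apply/eqP; rewrite eq_le xmin// andbT.
rewrite -subr_ge0; apply: le_trans (_ : _ <= remainder ip E dE u xbar) _.
  by apply: le_trans (b0P _ _ uO xO); rewrite mulr_ge0 ?powR_ge0 ?(ltW b0).
by rewrite /remainder du0 linear0l subr0.
Qed.

End DescentConsequences.
End Energy.

(** * The iterates of OMP *)

Section Iteration.
Set Implicit Arguments.
Unset Strict Implicit.
Context {R : realType} {H : completeNormedModType R}.
Context (ip : {dot H for idfun}) (Hip : norm_from_dot ip).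

Section Span.
Context (phi : nat -> H) (j : nat -> nat).

Lemma span_selected0 m : span_selected phi j m 0.
Proof. by exists (fun=> 0); rewrite big1// => i _; rewrite scale0r. Qed.

Lemma span_selected_shift m i t u : (0 < i <= m)%N -> span_selected phi j m u ->
  span_selected phi j m (u + t *: phi (j i)).
Proof.
move=> im [c ->]; exists (fun k => c k + (if k == i then t else 0)).
under [RHS]eq_bigr do rewrite scalerDl.
rewrite big_split /=; congr (_ + _).
rewrite (bigD1_seq i) ?iota_uniq//= ?mem_index_iota ?ltnS// eqxx.
by rewrite big1 ?addr0// => k /negPf ->; rewrite scale0r.
Qed.

Lemma span_selectedS m u : span_selected phi j m u -> span_selected phi j m.+1 u.
Proof.
move=> [c ->]; exists (fun k => if (k <= m)%N then c k else 0).
rewrite [RHS]big_nat_recr//= ltnn scale0r addr0 !big_nat.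
by apply: eq_bigr => i /andP[_]; rewrite ltnS => ->.
Qed.

Lemma coef_span_selected m u k :
  (forall i i', ip (phi i) (phi i') = (i == i')%:R) ->
  span_selected phi j m u ->
  (exists2 i, (0 < i <= m)%N & j i = k) \/ coef ip phi u k = 0.
Proof.
move=> phiP [c ->]; have [|none] := pselect (exists2 i, (0 < i <= m)%N & j i = k).
  by left.
right; rewrite /coef linear_sumlz /= big_nat big1// => i im.
rewrite linearZl_LR /= phiP; case: eqP => [ji|_]; last by rewrite mulr0.
by case: none; exists i.
Qed.

Lemma ip_span_selected m d u : (forall i, (0 < i <= m)%N -> ip d (phi (j i)) = 0) ->
  span_selected phi j m u -> ip d u = 0.
Proof.
move=> d0 [c ->]; rewrite linear_sumr /= big_nat big1// => i im.
by rewrite linearZr_LR /= d0 ?mulr0.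
Qed.

End Span.

(** Eliminates the distance r between the growth bound and the duality gap. *)
Lemma correlation_lower_bound (e b r A sq p : R) : 0 < e -> 0 < b -> 1 < p ->
  0 <= r -> 0 <= A -> 0 < sq -> e <= A * sq * r -> b * r `^ p <= e ->
  b `^ p^-1 * e `^ (1 - p^-1) / sq <= A.
Proof.
move=> e0 b0 p1 r0 A0 sq_gt0 gap grow.
have p0 : 0 < p by rewrite (lt_trans _ p1).
rewrite ler_pdivrMr//.
have br : b `^ p^-1 * r <= e `^ p^-1.
  have -> : r = (r `^ p) `^ p^-1 by rewrite -powRrM mulfV ?gt_eqF// powRr1.
  rewrite -powRM ?powR_ge0 ?(ltW b0)//.
  by rewrite ge0_ler_powR ?nnegrE ?invr_ge0 ?mulr_ge0 ?powR_ge0 ?(ltW b0) ?(ltW p0) ?(ltW e0).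
have bp := powR_gt0 p^-1 b0; have ep := powR_gt0 p^-1 e0.
rewrite powRB ?(gt_eqF e0) ?implybT// powRr1 ?(ltW e0)//.
rewrite mulrA ler_pdivrMr//.
apply: (@le_trans _ _ (A * sq * (b `^ p^-1 * r))).
  by rewrite mulrCA ler_wpM2l ?(ltW bp).
by rewrite ler_wpM2l ?mulr_ge0 ?(ltW sq_gt0).
Qed.

Section OMP.
Context (E : H -> R) (dE : H -> H) (K q p beta0 : R).
Context (K_gt0 : 0 < K) (q_gt1 : 1 < q) (p_ge2 : 2 <= p).
Context (descentE : forall u g, Omega E u -> `|g| = 1 ->
  exists t, E (u + t *: g) <= E u - K * `|ip (dE u) g| `^ (q / (q - 1))).
Context (b0P : is_beta0 ip E dE p beta0).
Context (phi : nat -> H) (phiB : orthonormal_basis ip phi).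
Context (xbar : H) (xbarP : solves_inf E xbar).
Context (xbar_fin : finite_set (supp ip phi xbar)).
Context (x : nat -> H) (xP : OMP_co ip E dE phi x).

Let S : R := #|` fset_set (supp ip phi xbar)|%:R.
Let e k : R := E (x k) - E xbar.

Lemma omp_Omega m : Omega E (x m).
Proof.
case: xP => x0 [j xS]; elim: m => [|m IH]; first by rewrite /Omega /= x0.
have [/(xS m).1 ->//|dn0] := pselect (dE (x m) = 0).
by have [_ [_ +]] := (xS m).2 dn0; apply; exact: span_selected0.
Qed.

Lemma omp_excess_ge0 m : 0 <= e m.
Proof. by rewrite subr_ge0; apply: xbarP.2; exact: omp_Omega. Qed.

Lemma omp_excess_eq0 m : e m = 0 -> x m = xbar.
Proof.
move=> em0; have p0 : 0 < p by apply: lt_le_trans p_ge2.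
have := growth Hip K_gt0 descentE b0P xbarP (omp_Omega m).
rewrite -/(e m) em0 pmulr_rle0 ?b0P.1// => le0.
have /powR_eq0_eq0/normr0_eq0/eqP : `|x m - xbar| `^ p = 0.
  by apply/eqP; rewrite eq_le le0 powR_ge0.
by rewrite subr_eq0 => /eqP.
Qed.

(** If x_m is already optimal or stationary then the algorithm has stopped there,
  so a positive excess after a step certifies that the step was performed. *)
Lemma omp_active m : 0 < e m.+1 -> 0 < e m /\ dE (x m) <> 0.
Proof.
have p0 : 0 < p by apply: lt_le_trans p_ge2.
have [_ [j xS]] := xP => em1.
have dn0 : dE (x m) <> 0.
  move=> d0; move: em1; rewrite /e ((xS m).1 d0).
  by rewrite (gradient0_eq_solution p0 b0P xbarP (omp_Omega m) d0) subrr ltxx.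
split=> //; rewrite lt_neqAle omp_excess_ge0 andbT; apply/eqP => /esym em0.
apply: dn0; rewrite (omp_excess_eq0 em0).
exact: (gradient0_at_solution Hip K_gt0 descentE xbarP).
Qed.

Lemma omp_excess_gt0 m k : 0 < e k -> (m <= k)%N -> 0 < e m.
Proof.
elim: k => [|k IH]; first by rewrite leqn0 => ? /eqP ->.
move=> ek; rewrite leq_eqVlt => /predU1P[->//|]; rewrite ltnS.
exact: (IH (omp_active ek).1).
Qed.

(** An empty support means xbar = 0, the starting point. *)
Lemma support_gt0 k : 0 < e k -> 0 < S.
Proof.
move=> ek; rewrite ltr0n lt0n; apply: contraTneq (omp_excess_gt0 ek (leq0n k)).
move=> /cardfs0_eq S0; have := finite_expansion phiB xbar_fin.
by rewrite /e S0 big_seq_fset0 xP.1 => ->; rewrite subrr ltxx.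
Qed.

Lemma omp_step m : 0 < e m.+1 ->
  e m.+1 <= e m - K * (beta0 `^ p^-1 * e m `^ (1 - p^-1)
                         / Num.sqrt S) `^ (q / (q - 1)).
Proof.
move=> em1; have [em0 dn0] := omp_active em1.
have phiP := phiB.1; have [x0 [j xS]] := xP.
set d := dE (x m) in dn0 *.
have [dmax [_ xmin]] := (xS m).2 dn0.
set A := `|ip d (phi (j m.+1))| in dmax.
(* At m = 0 the span is the single point 0 and minimality is trivial; later,
   step m was performed because the excess was positive before it. *)
have [xm_span xm_min] : is_minimizer E (span_selected phi j m) (x m).
  case: m em0 @d @A dn0 em1 {xmin dmax} => [|m] em0 d A dn0 em1; last first.
    have [_ dn0'] := omp_active em0.
    exact: ((xS m).2 dn0').2.
  by rewrite x0; split; [exact: span_selected0|move=> v [c ->]; rewrite big_geq].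
have dsel i : (0 < i <= m)%N -> ip d (phi (j i)) = 0.
  move=> im; apply: (line_minimizer_orthogonal K_gt0 descentE).
    exact: omp_Omega.
  by move=> t; apply: xm_min; exact: span_selected_shift.
have dA i : `|ip d (phi i)| <= A by apply: dmax; exists i; left.
(* By orthogonality the linear term of condition 2 between x_m and xbar reduces
   to the pairing with xbar. *)
have gap : e m <= A * Num.sqrt S * `|xbar - x m|.
  apply: (@le_trans _ _ `|ip d xbar|).
    have := b0P.2 _ _ (omp_Omega m) xbarP.1.
    rewrite /remainder -/d linearBr /= (ip_span_selected dsel xm_span) subr0.
    have := mulr_ge0 (ltW b0P.1) (powR_ge0 `|xbar - x m| p).
    by rewrite /e; have := lerNnormlW (lexx `|ip d xbar|); lra.
  apply: (sparse_gap Hip phiP (fset_uniq _)) => //.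
    exact: finite_expansion.
  move=> i; have [[k km <-]|] := coef_span_selected i phiP xm_span.
    by left; exact: dsel.
  by right.
have grow : beta0 * `|xbar - x m| `^ p <= e m.
  rewrite distrC; apply: (growth Hip K_gt0 descentE b0P xbarP).
  exact: omp_Omega.
have p1 : 1 < p by apply: lt_le_trans p_ge2; rewrite ltr1n.
have sq0 : 0 < Num.sqrt S by rewrite sqrtr_gt0 (support_gt0 em0).
have corr := correlation_lower_bound em0 b0P.1 p1
  (normr_ge0 _) (normr_ge0 _) sq0 gap grow.
have [t Et] := descentE (omp_Omega m) (norm_orthonormal Hip phiP (j m.+1)).
have em1_le : e m.+1 <= e m - K * A `^ (q / (q - 1)).
  have : E (x m.+1) <= E (x m + t *: phi (j m.+1)).
    by apply: xmin; apply: span_selected_shift; [rewrite ltnS leqnn|exact: span_selectedS].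
  by move: Et; rewrite /e -/d -/A; lra.
apply: le_trans em1_le _; rewrite lerD2l lerN2 ler_wpM2l ?(ltW K_gt0)//.
have q0 : 0 < q / (q - 1) by rewrite divr_gt0 ?subr_gt0// (lt_trans _ q_gt1).
apply: ge0_ler_powR => //; first exact: ltW.
  by rewrite nnegrE divr_ge0 ?(ltW sq0)// mulr_ge0 ?powR_ge0.
by rewrite nnegrE normr_ge0.
Qed.

Let theta : R := (p - q) / (p * (q - 1)).
Let sigma : R := q / (2 * (q - 1)).
Let K' : R := K * beta0 `^ (q / (p * (q - 1))).

Let p_gt0 : 0 < p. Proof. by apply: lt_le_trans p_ge2. Qed.
Let q1_gt0 : 0 < q - 1. Proof. by rewrite subr_gt0. Qed.

Lemma omp_rate_gt0 : 0 < K'.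
Proof. by rewrite mulr_gt0// powR_gt0// b0P.1. Qed.

Lemma omp_recurrence m : 0 < e m.+1 ->
  e m.+1 <= e m - K' * S `^ (- sigma) * e m `^ (1 + theta).
Proof.
move=> em1; apply: le_trans (omp_step em1) _.
have [em0 _] := omp_active em1; have S0 := support_gt0 em0.
rewrite lerD2l lerN2 le_eqVlt; apply/orP; left; apply/eqP.
rewrite -powR12_sqrt ?(ltW S0)// -powRN !powRM ?mulr_ge0 ?powR_ge0//.
rewrite -!powRrM /K'.
have -> : p^-1 * (q / (q - 1)) = q / (p * (q - 1)).
  by field; rewrite !gt_eqF.
have -> : (1 - p^-1) * (q / (q - 1)) = 1 + theta.
  by rewrite /theta; field; rewrite !gt_eqF.
have -> : - 2^-1 * (q / (q - 1)) = - sigma.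
  by rewrite /sigma; field; rewrite !gt_eqF.
by ring.
Qed.

Lemma omp_power_rate k : q < p -> 0 < e k -> (0 < k)%N ->
  e k <= (theta * K') `^ (- theta^-1) * S `^ (p * q / (2 * (p - q)))
         * k%:R `^ (- (p * (q - 1) / (p - q))).
Proof.
move=> qp ek k0; have pq0 : 0 < p - q by rewrite subr_gt0.
have S0 := support_gt0 ek; have K'0 := omp_rate_gt0.
have theta0 : 0 < theta by rewrite divr_gt0// mulr_gt0.
have KS : 0 < K' * S `^ (- sigma) by rewrite mulr_gt0// powR_gt0.
have := powR_recurrence_rate theta0 KS (fun m => @omp_excess_gt0 m k ek).
move=> /(_ (fun m mk => omp_recurrence (omp_excess_gt0 ek mk)) k0) /le_trans; apply.
rewrite le_eqVlt; apply/orP; left; apply/eqP.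
have tK0 : 0 <= theta * K' by rewrite (mulr_ge0 (ltW theta0) (ltW K'0)).
rewrite mulrA (powRM _ (mulr_ge0 tK0 (powR_ge0 _ _)) (ler0n _ _)).
rewrite (powRM _ tK0 (powR_ge0 _ _)) -powRrM.
congr (_ * _ `^ _ * _ `^ _).
  by rewrite /sigma /theta; field; rewrite !gt_eqF.
by rewrite /theta; field; rewrite !gt_eqF.
Qed.

Lemma omp_power_rate_dist k : q < p -> 0 < e k -> (0 < k)%N ->
  `|x k - xbar| <= ((theta * K') `^ (- theta^-1) / beta0) `^ p^-1
         * S `^ (q / (2 * (p - q))) * k%:R `^ (- ((q - 1) / (p - q))).
Proof.
move=> qp ek k0; have pq0 : 0 < p - q by rewrite subr_gt0.
have b0 := b0P.1.
have rE : `|x k - xbar| = (`|x k - xbar| `^ p) `^ p^-1.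
  by rewrite -powRrM mulfV ?gt_eqF// powRr1.
rewrite rE; set D := (theta * K') `^ _.
have -> : S `^ (q / (2 * (p - q))) = (S `^ (p * q / (2 * (p - q)))) `^ p^-1.
  by rewrite -powRrM; congr (_ `^ _); field; rewrite !gt_eqF.
have -> : (k%:R : R) `^ (- ((q - 1) / (p - q)))
    = (k%:R `^ (- (p * (q - 1) / (p - q)))) `^ p^-1.
  by rewrite -powRrM; congr (_ `^ _); field; rewrite !gt_eqF.
have D0 : 0 <= D / beta0 by rewrite divr_ge0 ?powR_ge0 ?(ltW b0).
rewrite -(powRM _ D0 (powR_ge0 _ _)).
have DS0 := mulr_ge0 D0 (powR_ge0 S (p * q / (2 * (p - q)))).
rewrite -(powRM _ DS0 (powR_ge0 _ _)).
apply: ge0_ler_powR; rewrite ?nnegrE ?powR_ge0 ?(mulr_ge0 DS0) ?powR_ge0//.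
  by rewrite invr_ge0 ltW.
rewrite -(ler_pM2l b0); apply: le_trans (_ : _ <= e k) _.
  exact: (growth Hip K_gt0 descentE b0P xbarP (omp_Omega k)).
rewrite -[D / beta0 * _ * _]mulrA -[D / beta0 * _]mulrA mulrCA mulVKf ?gt_eqF//.
by rewrite mulrA omp_power_rate.
Qed.

(** The constant c replaces the actual rate K', so that it can be chosen small
  enough for 1 - c / S to be positive. *)
Lemma omp_linear_rate (c : R) k : p = 2 -> q = 2 -> c <= K' -> c <= S ->
  0 < e k -> e k <= (E 0 - E xbar) * (1 - c / S) ^+ k.
Proof.
move=> p2 q2 cK cS; elim: k => [|k IH] ek.
  by rewrite /e xP.1 expr0 mulr1.
have [ek0 _] := omp_active ek; have S0 := support_gt0 ek.
apply: le_trans (omp_recurrence ek) _.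
have -> : 1 + theta = 1 by rewrite /theta p2 q2 subrr mul0r addr0.
have -> : - sigma = -1 by rewrite /sigma q2; field.
rewrite powRr1 ?(ltW ek0)// powR_inv1 ?(ltW S0)//.
apply: (@le_trans _ _ (e k * (1 - c / S))).
  have -> : e k * (1 - c / S) = e k - c / S * e k by ring.
  by rewrite lerD2l lerN2 ler_wpM2r ?(ltW ek0)// ler_wpM2r ?invr_ge0 ?(ltW S0).
rewrite exprSr mulrA ler_wpM2r ?IH//.
by rewrite subr_ge0 ler_pdivrMr// mul1r.
Qed.

End OMP.
End Iteration.

(** * Constants depending on E only *)

Section Uniformity.
Context {R : realType} {H : completeNormedModType R}.
Context (ip : {dot H for idfun}) (Hip : norm_from_dot ip) (E : H -> R).
Set Implicit Arguments.
Unset Strict Implicit.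

Lemma conditions_transfer dE dE' (M0 M0' M alpha beta p q : R) :
  condition0 ip E dE M0 -> condition0 ip E dE' M0' ->
  condition1 ip E dE M alpha q -> condition2 ip E dE M beta p ->
  [/\ condition0 ip E dE' M0, condition1 ip E dE' M alpha q
    & condition2 ip E dE' M beta p].
Proof.
move=> C0 C0' C1 C2.
have dEE u : Omega E u -> dE' u = dE u.
  by move=> uO; apply: (gradient_unique Hip (C0' u uO).1 (C0 u uO).1).
split=> [u uO|u v uO uv|u v uO uv].
- by rewrite dEE//; exact: C0.
- by rewrite /remainder dEE//; exact: C1.
- by rewrite /remainder dEE//; exact: C2.
Qed.

(** One beta0 for all gradient maps, since the diameter of Omega does not depend
  on them. *)
Lemma beta0_of_bounded (M beta p : R) : convex_function [set: H] E ->
  bounded_set (Omega E) -> 0 < M -> 0 < beta ->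
  exists beta0, forall dE, condition2 ip E dE M beta p -> is_beta0 ip E dE p beta0.
Proof.
move=> Ecvx bnd M_gt0 b0.
have [B [_ /(_ (`|B| + 1)) EB]] := bnd.
have {}EB u : Omega E u -> `|u| <= `|B| + 1.
  by apply: EB; rewrite (le_lt_trans (ler_norm B))// ltrDl.
pose D : R := `|B| + 1; have D0 : 0 < D by rewrite ltr_wpDl.
exists (Num.min beta (beta * ((D + D) / M) `^ (1 - p))) => dE C2.
apply: (beta0_min Ecvx M_gt0 b0 C2); first by rewrite divr_gt0// addr_gt0.
move=> u v uO vO; rewrite divfK ?gt_eqF//; apply: le_trans (ler_normB _ _) _.
by rewrite lerD ?EB.
Qed.

End Uniformity.

(** * Convergence rates *)

Theorem theorem4p5 (R : realType) (H : completeNormedModType R)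
    (ip : {dot H for idfun}) (Hip : norm_from_dot ip)
    (E : H -> R) (E_convex : convex_function [set: H] E)
    (Omega_bounded : bounded_set (Omega E))
    (alpha q beta p : R) (alpha_gt0 : 0 < alpha) (q_gt1 : 1 < q) (q_le2 : q <= 2)
    (beta_gt0 : 0 < beta) (p_ge2 : 2 <= p) :
  (* the constants may depend on p, q, alpha, beta and E only *)
  exists C C' C3 : R, [/\ 0 < C, 0 < C', 0 < C3 &
  forall (dE : H -> H) (M0 M : R) (phi : nat -> H) (xbar : H) (x : nat -> H),
  0 < M ->
  orthonormal_basis ip phi ->
  condition0 ip E dE M0 ->
  condition1 ip E dE M alpha q ->
  condition2 ip E dE M beta p ->
  solves_inf E xbar ->
  finite_set (supp ip phi xbar) ->
  OMP_co ip E dE phi x ->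
  let S : R := #|` fset_set (supp ip phi xbar)|%:R in
  let e (k : nat) : R := E (x k) - E xbar in
  let gamma : R := 1 - C3 / S in
  let C2 : R := E 0 - E xbar in
  forall k : nat,
    (x k = xbar /\ e k = 0) \/
    ((p <> q -> (2 <= k)%N ->
        e k <= C * S `^ (p * q / (2 * (p - q)))
                 * k%:R `^ (- (p * (q - 1) / (p - q))) /\
        `|x k - xbar| <= C' * S `^ (q / (2 * (p - q)))
                            * k%:R `^ (- ((q - 1) / (p - q)))) /\
     (p = 2 -> q = 2 ->
        0 < gamma < 1 /\
        ((2 <= k)%N ->
           e k <= C2 * gamma ^+ (k - 1) /\
           forall beta0 : R, is_beta0 ip E dE p beta0 ->
             `|x k - xbar| <= C2 `^ (1 / 2) * beta0 `^ (- (1 / 2))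
                                * gamma `^ ((k%:R - 1) / 2))))].
Proof.
have q1_gt0 : 0 < q - 1 by rewrite subr_gt0.
have p_gt0 : 0 < p by apply: lt_le_trans p_ge2.
(* The constants come from one admissible gradient with its bounds; if there is
   none, the claim is vacuous. *)
have [[dE1 [M01 [M1 [M1_gt0 C01 C11 C21]]]]|none] := pselect (exists dE M0 M,
    [/\ 0 < M, condition0 ip E dE M0, condition1 ip E dE M alpha q
      & condition2 ip E dE M beta p]); last first.
  exists 1, 1, 1; split=> // dE M0 M phi xbar x M_gt0 _ C0 C1 C2.
  by case: none; exists dE, M0, M.
have [K K_gt0 desc] := descent Hip M01 M1_gt0 alpha_gt0 q_gt1.
have [b bP] := beta0_of_bounded ip p E_convex Omega_bounded M1_gt0 beta_gt0.
have b_gt0 : 0 < b := (bP dE1 C21).1.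
pose theta : R := (p - q) / (p * (q - 1)).
pose K' : R := K * b `^ (q / (p * (q - 1))).
have K'_gt0 : 0 < K' by rewrite mulr_gt0// powR_gt0.
pose C : R := (theta * K') `^ (- theta^-1).
(* For theta = 0 the formula for C is meaningless but still positive. *)
have C_gt0 : 0 < C.
  have [theta0|theta0] := eqVneq theta 0.
    by rewrite /C theta0 invr0 oppr0 powRr0.
  rewrite powR_gt0// mulr_gt0// lt_neqAle eq_sym theta0.
  by rewrite divr_ge0 ?subr_ge0 ?(le_trans q_le2)// ltW// mulr_gt0.
(* Capping the rate at 1/2 keeps gamma positive when the support has size 1. *)
exists C, ((C / b) `^ p^-1), (Num.min K' (1 / 2)); split=> //.
- by rewrite powR_gt0// divr_gt0.
- by rewrite lt_min K'_gt0 divr_gt0.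
move=> dE M0 M phi xbar x _ phiB C0 _ _ xbarP xbar_fin xP S e gamma C2 k.
have [C0' C1' C2'] := conditions_transfer Hip C01 C0 C11 C21.
have descE := desc _ _ C0' C1'; have bE := bP _ C2'.
have [ek0|ek0] := eqVneq (e k) 0.
  left; split=> //.
  exact: (omp_excess_eq0 Hip K_gt0 p_ge2 descE bE xbarP xP).
have ek : 0 < e k.
  by rewrite lt_neqAle eq_sym ek0 (omp_excess_ge0 xbarP xP).
right; split=> [pq k2|p2 q2].
  have qp : q < p by rewrite lt_neqAle eq_sym (introN eqP pq) (le_trans q_le2).
  have k0 := ltnW k2; split.
    exact: (omp_power_rate Hip K_gt0 q_gt1 p_ge2 descE bE phiB xbarP xbar_fin xP).
  exact: (omp_power_rate_dist Hip K_gt0 q_gt1 p_ge2 descE bE phiB xbarP xbar_fin xP).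
have S1 : 1 <= S.
  have := support_gt0 Hip K_gt0 p_ge2 descE bE phiB xbarP xbar_fin xP ek.
  by rewrite ltr0n ler1n.
have S0 : 0 < S := lt_le_trans ltr01 S1.
set c := Num.min _ _ in gamma *.
have c0 : 0 < c by rewrite lt_min K'_gt0 divr_gt0.
have c1 : c < 1.
  by rewrite gt_min; apply/orP; right; lra.
have gamma01 : 0 < gamma < 1.
  rewrite subr_gt0 ltr_pdivrMr// mul1r (lt_le_trans c1)//=.
  by rewrite gtrDl oppr_lt0 divr_gt0.
split=> // k2; have [gamma0 gamma1] := andP gamma01.
have C2_ge0 : 0 <= C2 by rewrite subr_ge0; exact: xbarP.1.
have rate : e k <= C2 * gamma ^+ (k - 1).
  apply: le_trans (_ : _ <= C2 * gamma ^+ k) _.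
    apply: (omp_linear_rate Hip K_gt0 q_gt1 p_ge2 descE bE phiB xbarP xbar_fin xP) => //.
      by rewrite ge_min lexx.
    exact: le_trans (ltW c1) S1.
  rewrite ler_wpM2l//; apply: ler_wiXn2l; [exact: ltW|exact: ltW|exact: leq_subr].
split=> // b' b'P; have b'0 := b'P.1.
have := growth Hip K_gt0 descE b'P xbarP (omp_Omega xP k).
rewrite p2 (powR_mulrn 2)// => /le_trans /(_ rate) dist.
have k1 : (1 <= k)%N := ltnW k2.
have -> : (k%:R - 1) / 2 = (k - 1)%:R * 2^-1 :> R by rewrite natrB.
rewrite !div1r powRrM powR_mulrn ?(ltW gamma0)//.
have -> : b' `^ (- 2^-1) = b'^-1 `^ 2^-1.
  by rewrite -(powR_inv1 (ltW b'0)) -powRrM mulN1r.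
have G0 : 0 <= gamma ^+ (k - 1) by rewrite exprn_ge0 ?(ltW gamma0).
have bi0 : 0 <= b'^-1 by rewrite invr_ge0 ltW.
rewrite -powRM// -powRM ?mulr_ge0// powR12_sqrt ?mulr_ge0//.
rewrite -[leLHS]ger0_norm// -sqrtr_sqr ler_wsqrtr//.
by rewrite mulrAC ler_pdivlMr// mulrC.
Qed.
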